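(* There exist acyclic dynamic flow networks with only one capacity change in which every minimum dynamic cut has exponential complexity while there exists a maximum dynamic flow of linear complexity: for every $k\in\mathbb{N}^+$ there is such a network of size polynomial in $k$ in which every minimum cut has complexity exponential in $k$ and some maximum flow has complexity linear in the size of the network. The same is true for static capacities and time-dependent transit times with only one transit time change.
   Context: A dynamic flow network with time-dependent capacities: directed graph $G=(V,E)$, source $s$, target $t$, time horizon $T$, constant transit times $\tau_e\ge0$, capacity functions $u_e\colon[0,T]\to\mathbb{R}_{\ge0}$ with finitely many discontinuities; ''one capacity change'' means all capacities constant except one edge with a single jump. In the variant with time-dependent transit times, capacities are constant and transit times $\tau_e(\Theta)$ (for flow entering at $\Theta$) are constant except for a single jump of one edge. A dynamic flow is a family of measurable $f_e$ with $f_e\le u_e$, no flow before time $0$ or arriving after $T$, and strong flow conservation at every $v\ne s,t$ at every time; its value is the flow arrived at $t$ by $T$. A dynamic cut is a family $S_v\colon[0,T]\to\{0,1\}$ with $S_s\equiv1$, $S_t\equiv0$, $S_v(\Theta)=1$ for $\Theta>T$, of capacity $\int_0^T\sum_{e=(v,w):S_v(\Theta)=1,S_w(\Theta+\tau_e)=0}u_e(\Theta)d\Theta$. The complexity of a cut is the total number of partition switches of all vertices; the complexity of a flow is the total number of changes of all functions $f_e$. *)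

(* Defs.v *)
From HB Require Import structures.
From mathcomp Require Import all_boot all_order all_algebra.
From mathcomp Require Import all_classical all_reals all_analysis.
Set Implicit Arguments. Unset Strict Implicit. Unset Printing Implicit Defensive.
Import Order.TTheory GRing.Theory Num.Theory.
Import numFieldNormedType.Exports.
Local Open Scope classical_set_scope.
Local Open Scope ring_scope.

Record dnet (R : realType) := DNet {
  dV : nat;
  dE : nat;
  dtl : 'I_dE -> 'I_dV;
  dhd : 'I_dE -> 'I_dV;
  dsrc : 'I_dV;
  dsnk : 'I_dV;
  dT : R;
  dtau : 'I_dE -> R -> R;        (* transit time of flow entering at Theta *)
  du : 'I_dE -> R -> R
}.
Arguments dV {R} d. Arguments dE {R} d. Arguments dtl {R} d _.
Arguments dhd {R} d _. Arguments dsrc {R} d. Arguments dsnk {R} d.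
Arguments dT {R} d. Arguments dtau {R} d _ _. Arguments du {R} d _ _.

Section DynFlows.
Variable R : realType.
Variable N : dnet R.

Definition Tint : set R := `[0, dT N]%classic.

(* Rate at which flow on edge e arrives at its head at time th:
   sum of f_e(Theta) over all entering times Theta with Theta + tau_e(Theta) = th.
   For constant transit time this is f_e(th - tau_e). *)
Definition arrival (f : 'I_(dE N) -> R -> R) (e : 'I_(dE N)) (th : R) : R :=
  \sum_(x \in [set x : R | x + dtau N e x = th]) f e x.

Definition is_dyn_flow (f : 'I_(dE N) -> R -> R) : Prop :=
  (forall e, measurable_fun setT (f e)) /\
  (forall e x, 0 <= f e x) /\
  (forall e x, Tint x -> f e x <= du N e x) /\
  (forall e x, x < 0 -> f e x = 0) /\
  (forall e x, dT N < x + dtau N e x -> f e x = 0) /\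
  (forall (v : 'I_(dV N)) (th : R), v != dsrc N -> v != dsnk N ->
     \sum_(e | dhd N e == v) arrival f e th = \sum_(e | dtl N e == v) f e th).

Definition flow_value (f : 'I_(dE N) -> R -> R) : \bar R :=
  \int[lebesgue_measure]_(th in Tint)
     ((\sum_(e | dhd N e == dsnk N) arrival f e th)
      - \sum_(e | dtl N e == dsnk N) f e th)%:E.

Definition is_max_flow f : Prop :=
  is_dyn_flow f /\ forall g, is_dyn_flow g -> (flow_value g <= flow_value f)%E.

(* dynamic cuts: S v Theta = true means v is on the source side at Theta *)
Definition is_dyn_cut (S : 'I_(dV N) -> R -> bool) : Prop :=
  (forall v, measurable [set x | S v x]) /\
  (forall x, Tint x -> S (dsrc N) x = true) /\
  (forall x, Tint x -> S (dsnk N) x = false) /\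
  (forall v x, dT N < x -> S v x = true).

Definition cut_capacity (S : 'I_(dV N) -> R -> bool) : \bar R :=
  \int[lebesgue_measure]_(x in Tint)
     (\sum_(e | S (dtl N e) x && ~~ S (dhd N e) (x + dtau N e x)) du N e x)%:E.

Definition is_min_cut S : Prop :=
  is_dyn_cut S /\ forall S', is_dyn_cut S' -> (cut_capacity S <= cut_capacity S')%E.

End DynFlows.
Arguments arrival {R} N f e th.
Arguments is_dyn_flow {R} N f.
Arguments flow_value {R} N f.
Arguments is_max_flow {R} N f.
Arguments is_dyn_cut {R} N S.
Arguments cut_capacity {R} N S.
Arguments is_min_cut {R} N S.

Definition has_changes (R : realType) (T : eqType) (D : set R) (g : R -> T)
    (m : nat) : Prop :=
  exists x : nat -> R,
    (forall i, (i <= m)%N -> D (x i)) /\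
    (forall i, (i < m)%N -> x i < x i.+1) /\
    (forall i, (i < m)%N -> g (x i) != g (x i.+1)).

Definition family_changes_le (R : realType) (I : finType) (T : eqType)
    (D : set R) (g : I -> R -> T) (K : nat) : Prop :=
  exists m : I -> nat,
    (forall i, ~ has_changes D (g i) (m i).+1) /\ (\sum_(i : I) m i <= K)%N.

Definition family_changes_ge (R : realType) (I : finType) (T : eqType)
    (D : set R) (g : I -> R -> T) (L : nat) : Prop :=
  forall K, family_changes_le D g K -> (L <= K)%N.

Definition cut_complexity_ge (R : realType) (N : dnet R) (S : 'I_(dV N) -> R -> bool)
    (L : nat) : Prop := family_changes_ge (Tint N) S L.
Definition flow_complexity_le (R : realType) (N : dnet R) (f : 'I_(dE N) -> R -> R)
    (K : nat) : Prop := family_changes_le setT f K.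

Record cnet := CNet {
  nV : nat;
  nE : nat;
  tl : 'I_nE -> 'I_nV;
  hd : 'I_nE -> 'I_nV;
  src : 'I_nV;
  snk : 'I_nV;
  horizon : nat;
  base_tau : 'I_nE -> nat;
  base_cap : 'I_nE -> nat;
  ch_edge : 'I_nE;
  ch_time : nat;
  ch_val : nat
}.
Arguments tl c _ : clear implicits. Arguments hd c _ : clear implicits. Arguments base_tau c _ : clear implicits.
Arguments base_cap c _ : clear implicits.

Definition acyclic (N : cnet) : Prop :=
  ~ exists (m : nat) (es : nat -> 'I_(nE N)),
      (0 < m)%N /\ forall i, (i < m)%N -> hd N (es i) = tl N (es ((i.+1) %% m)%N).

Definition bits (x : nat) : nat := (trunc_log 2 x).+1.

Definition net_size (N : cnet) : nat :=
  nV N + nE N + bits (horizon N) + bits (ch_time N) + bits (ch_val N)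
  + \sum_(e : 'I_(nE N)) (bits (base_tau N e) + bits (base_cap N e)).

Definition cap_change_net (R : realType) (N : cnet) : dnet R :=
  @DNet R (nV N) (nE N) (tl N) (hd N) (src N) (snk N) (horizon N)%:R
    (fun e _ => (base_tau N e)%:R)
    (fun e x => if (e == ch_edge N) && ((ch_time N)%:R <= x)
                then (ch_val N)%:R else (base_cap N e)%:R).

Definition tau_change_net (R : realType) (N : cnet) : dnet R :=
  @DNet R (nV N) (nE N) (tl N) (hd N) (src N) (snk N) (horizon N)%:R
    (fun e x => if (e == ch_edge N) && ((ch_time N)%:R <= x)
                then (ch_val N)%:R else (base_tau N e)%:R)
    (fun e _ => (base_cap N e)%:R).

Definition one_cap_change (N : cnet) : Prop :=
  src N != snk N /\ (0 < ch_time N < horizon N)%N /\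
  ch_val N != base_cap N (ch_edge N).
Definition one_tau_change (N : cnet) : Prop :=
  src N != snk N /\ (0 < ch_time N < horizon N)%N /\
  ch_val N != base_tau N (ch_edge N).

(* Main.v *)
Require Import Defs.
From HB Require Import structures.
From mathcomp Require Import all_boot all_order all_algebra.
From mathcomp Require Import all_classical all_reals all_analysis.
From mathcomp Require Import measurable_realfun.
From mathcomp Require Import ring lra zify.

(** Flow sent through the relay [a] during [[0, 2K)], [K = 2^k], leaves spare
    capacity out of the source only in the window [[2K-1, 2K)] and, after time
    [2K-2], spare capacity into the sink only in the window [[4K-2, 4K-1]].
    The chain [x_0, ..., x_2k] carries no flow, and
    its edges have delays 0 and twice a power of two.  By complementary
    slackness a minimum cut contains everything reachable from the source window
    through the chain and nothing that reaches the sink window; at [x_k] these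
    are alternating unit intervals, [K] of each kind, while the flow itself
    changes only a bounded number of times per edge.  The slack conditions hold
    almost everywhere, hence simultaneously at [y + n] for all naturals [n] and
    a suitable [y] in [(0, 1)], which makes the argument discrete. *)

Set Implicit Arguments.
Unset Strict Implicit.
Unset Printing Implicit Defensive.
Import Order.TTheory GRing.Theory Num.Theory.
Import numFieldNormedType.Exports.
Local Open Scope classical_set_scope.
Local Open Scope ring_scope.

(** * Translation invariance of Lebesgue measure, of integrals and of null sets *)

Section Translation.
Context {R : realType}.
Implicit Types (h : R) (A : set R).
Local Notation mu := (@lebesgue_measure R).

Lemma measurable_translation h :
  measurable_fun [set: R] (fun x : R => x + h).
Proof. exact: measurable_funD. Qed.

(** Uniqueness of Lebesgue measure: the pushforward gives every half-open interval its length. *)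
Lemma lebesgue_measure_translation h A : measurable A ->
  pushforward mu (fun x : R => x + h : measurableTypeR R) A = mu A.
Proof.
have mh := measurable_translation h.
pose hM := isMeasurableFun.Build _ _ _ _ (fun x : R => x + h : measurableTypeR R) mh.
pose hP : {mfun _ >-> _} := HB.pack (fun x : R => x + h : measurableTypeR R) hM.
move=> mA; apply/esym/(@lebesgue_measure_unique _ (pushforward mu hP)) => //=.
move=> _ [[a b]] _ <-; rewrite /pushforward.
have -> : (fun x : R => x + h : measurableTypeR R) @^-1` `]a, b]%classic =
    `](a - h), (b - h)]%classic.
  by apply/seteqP; split => x /=; rewrite !in_itv /= ltrBlDr lerBrDr.
rewrite !lebesgue_measure_itv/= !lte_fin ltrD2r; case: ifPn => // _.
by congr EFin; ring.
Qed.

Lemma ge0_integral_translation h (f : R -> \bar R) :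
  measurable_fun setT f -> (forall x, 0 <= f x)%E ->
  (\int[mu]_x f (x + h)%R = \int[mu]_x f x)%E.
Proof.
move=> mf f0.
have mh := measurable_translation h.
transitivity (\int[pushforward mu (fun x : R => (x + h)%R : measurableTypeR R)]_x f x)%E.
  by rewrite ge0_integral_pushforward.
by apply: eq_measure_integral => //= A mA _; exact: lebesgue_measure_translation.
Qed.

Lemma ae_translation h (P : R -> Prop) :
  (\forall x \ae mu, P x) -> \forall x \ae mu, P (x + h).
Proof.
case=> A [mA A0 PA]; exists ((fun x : R => x + h : measurableTypeR R) @^-1` A).
split.
- by rewrite -[_ @^-1` _]setTI; exact: measurable_translation.
- by have := lebesgue_measure_translation h mA; rewrite A0.
- by move=> x /PA.
Qed.

End Translation.

(** * Auxiliary facts on measurability, integrability and extended reals *)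

Lemma measurable_fun_boolr (R : realType) (D : set R) (b : R -> bool) :
  measurable [set x | b x] -> measurable_fun D (fun x => (b x)%:R : R).
Proof.
move=> mb; have -> : (fun x => (b x)%:R : R) = \1_[set x | b x].
  apply/funext => x; rewrite indicE; congr (nat_of_bool _)%:R.
  by apply/idP/idP => [bx|]; [exact/mem_set | rewrite inE].
exact: measurable_indic.
Qed.

Lemma integrable_bounded_itv (R : realType) (a b M : R) (g : R -> R) :
  measurable_fun `[a, b] g -> (forall x, `[a, b]%classic x -> `|g x| <= M) ->
  (@lebesgue_measure R).-integrable `[a, b] (EFin \o g).
Proof.
move=> mg gM; apply: measurable_bounded_integrable => //.
  by rewrite [X in (X < _)%E]lebesgue_measure_itv /=; case: ifP => _; rewrite ?ltry.
by exists M; split; [exact: num_real|] => y My x /gM /le_trans; apply; exact: ltW.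
Qed.

Lemma fin_num_addeI (R : realType) (x y z : \bar R) :
  x \is a fin_num -> (x + y = x + z)%E -> y = z.
Proof.
by move=> xf; rewrite addeC [RHS]addeC => yz; rewrite -(addeK y xf) yz addeK.
Qed.

(** * Weak duality and complementary slackness for constant transit times *)

Section Duality.
Context {R : realType}.
Variables (N : dnet R) (tau : 'I_(dE N) -> R) (M : R).
Hypotheses (tau_ge0 : forall e, 0 <= tau e)
  (dtauE : forall e x, dtau N e x = tau e)
  (mdu : forall e, measurable_fun setT (du N e))
  (du_ge0 : forall e x, 0 <= du N e x)
  (duM : forall e x, du N e x <= M).
Local Notation mu := (@lebesgue_measure R).
Local Notation I := (Tint N).
Implicit Types (f : 'I_(dE N) -> R -> R) (S : 'I_(dV N) -> R -> bool).

Let mI : measurable I. Proof. exact: measurable_itv. Qed.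

Lemma arrival_constE f e th : arrival N f e th = f e (th - tau e).
Proof.
rewrite /arrival (_ : [set x | _] = [set th - tau e]) ?fsbig_set1//.
apply/seteqP; split => x /=; rewrite dtauE.
  by move=> <-; rewrite addrK.
by move=> ->; rewrite subrK.
Qed.

(** Defect in complementary slackness: [u - f] on an edge leaving the source side, [f] on an edge
    entering it, 0 on any other edge. *)
Definition slack f S e x : R :=
  du N e x * (S (dtl N e) x && ~~ S (dhd N e) (x + dtau N e x))%:R
  - f e x * ((S (dtl N e) x)%:R - (S (dhd N e) (x + dtau N e x))%:R).

Lemma slack_ge0 f S e x : is_dyn_flow N f -> I x -> 0 <= slack f S e x.
Proof.
move=> [_ [f0 [fu _]]] Ix; rewrite /slack.
have := f0 e x; have := fu e x Ix.
by case: (S _ _); case: (S _ _) => /=; rewrite ?mulr1n ?mulr0n => ? ?; lra.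
Qed.

Section Gap.
Variables (f : 'I_(dE N) -> R -> R) (S : 'I_(dV N) -> R -> bool).
Hypotheses (ff : is_dyn_flow N f) (SS : is_dyn_cut N S).

Let side v x : R := (~~ S v x)%:R.

Let mside v (h : R) : measurable_fun setT (fun x : R => side v (x + h)).
Proof.
apply: measurable_fun_boolr; rewrite [X in measurable X](_ : _ =
  (fun x : R => x + h : R) @^-1` (~` [set x | S v x])).
  rewrite -[_ @^-1` _]setTI; apply: measurable_translation => //.
  by apply: measurableC; have [mS _] := SS; exact: mS.
by apply/seteqP; split => x /= /negP.
Qed.

Let mside0 v : measurable_fun setT (side v).
Proof.
by rewrite (_ : side v = fun x => side v (x + 0)) //; apply/funext => x; rewrite addr0.
Qed.

Let mf e : measurable_fun setT (f e).
Proof. by have [mf _] := ff; exact: mf. Qed.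

Let mfh e (h : R) : measurable_fun setT (fun x : R => f e (x + h)).
Proof. exact: measurableT_comp (mf e) (measurable_translation h). Qed.

Let f_ge0 e x : 0 <= f e x.
Proof. by have [_ [f0 _]] := ff; exact: f0. Qed.

(** Needed to extend integrals over the horizon to the whole line, where they can be translated;
    [f_late] does the same for arrival times. *)
Let f_out e x : ~ I x -> f e x = 0.
Proof.
have [_ [_ [_ [fl [fr _]]]]] := ff.
rewrite /Tint /= in_itv /= => /negP; rewrite negb_and -!ltNge => /orP[/fl//|Tx].
by apply: fr; rewrite dtauE; apply: lt_le_trans Tx _; rewrite lerDl.
Qed.

Let f_late e x : ~ I x -> f e (x - tau e) = 0.
Proof.
have [_ [_ [_ [fl [fr _]]]]] := ff.
rewrite /Tint /= in_itv /= => /negP; rewrite negb_and -!ltNge => /orP[x0|Tx].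
  by apply: fl; rewrite subr_lt0; exact: lt_le_trans x0 _.
by apply: fr; rewrite dtauE subrK.
Qed.

Let M0 (e : 'I_(dE N)) : 0 <= M. Proof. exact: le_trans (du_ge0 e 0) (duM e 0). Qed.

Let fM e x : f e x <= M.
Proof.
have [Ix|/f_out->] := pselect (I x); last exact: (M0 e).
by have [_ [_ [fu _]]] := ff; exact: le_trans (fu e x Ix) (duM e x).
Qed.

Let side_ge0 v x : 0 <= side v x. Proof. by rewrite /side ler0n. Qed.
Let side_le1 v x : side v x <= 1. Proof. by rewrite /side lern1 leq_b1. Qed.

Let intf e (h : R) : mu.-integrable I (EFin \o (fun x : R => f e (x + h))).
Proof.
apply: (@integrable_bounded_itv _ _ _ M); first exact: measurable_funTS (mfh _ _).
by move=> x _; rewrite ger0_norm.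
Qed.

Let integrable_sumf (P : pred 'I_(dE N)) (h : 'I_(dE N) -> R) :
  mu.-integrable I (EFin \o (fun x : R => \sum_(e | P e) f e (x + h e))).
Proof.
rewrite (_ : _ \o _ = fun x => (\sum_(e <- enum P) (f e (x + h e))%:E)%E).
  by apply: integrable_sum => // e _; exact: intf.
by apply/funext => x /=; rewrite big_enum/= sumEFin.
Qed.

(* Weighting flow conservation at v by the indicator of the sink side leaves
   only the sink, whose excess is thus an edge sum. *)
Let sink_excessE x : I x ->
  \sum_(e | dhd N e == dsnk N) arrival N f e x
    - \sum_(e | dtl N e == dsnk N) f e x
  + \sum_e side (dtl N e) x * f e x
  = \sum_e side (dhd N e) x * f e (x - tau e).
Proof.
move=> Ix; have [_ [Ss [St _]]] := SS.
have [_ [_ [_ [_ [_ cons]]]]] := ff.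
pose exc v := \sum_(e | dhd N e == v) arrival N f e x
              - \sum_(e | dtl N e == v) f e x.
have -> : \sum_(e | dhd N e == dsnk N) arrival N f e x
    - \sum_(e | dtl N e == dsnk N) f e x = \sum_v side v x * exc v.
  rewrite [RHS](bigD1 (dsnk N)) //= {1}/side St // mul1r.
  rewrite [X in _ = _ + X]big1 ?addr0 // => v vt.
  have [->|vs] := eqVneq v (dsrc N); first by rewrite /side Ss // mul0r.
  by rewrite /exc cons // subrr mulr0.
under eq_bigr do rewrite mulrBr !mulr_sumr.
rewrite sumrB.
have part (h : 'I_(dE N) -> 'I_(dV N)) (g : 'I_(dE N) -> R) :
    \sum_v \sum_(e | h e == v) side v x * g e = \sum_e side (h e) x * g e.
  rewrite (exchange_big_dep xpredT) //=; apply: eq_bigr => e _.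
  by rewrite (big_pred1 (h e)) // => v; rewrite eq_sym.
rewrite !part subrK; apply: eq_bigr => e _; by rewrite arrival_constE.
Qed.

(** A finite term added to both sides of the duality identity, so that no difference of extended
    reals occurs. *)
Let X := (\int[mu]_(x in I) (\sum_e side (dtl N e) x * f e x)%:E)%E.

Let int_tl : mu.-integrable I (EFin \o (fun x : R => \sum_e side (dtl N e) x * f e x)).
Proof.
rewrite (_ : _ \o _ = fun x =>
  (\sum_(e <- index_enum 'I_(dE N)) (side (dtl N e) x * f e x)%:E)%E).
  apply: integrable_sum => // e _.
  apply: (@integrable_bounded_itv _ _ _ M).
    by apply: measurable_funTS; apply: measurable_funM.
  move=> x _; rewrite ger0_norm ?mulr_ge0 //.
  by apply: le_trans (fM e x); rewrite ler_piMl.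
by apply/funext => x /=; rewrite sumEFin.
Qed.

Let integrable_excess : mu.-integrable I (fun x =>
  (\sum_(e | dhd N e == dsnk N) arrival N f e x
   - \sum_(e | dtl N e == dsnk N) f e x)%:E).
Proof.
rewrite (_ : (fun x => _) =
    ((EFin \o (fun x : R => (\sum_(e | dhd N e == dsnk N) f e (x + - tau e))%R))
     \- (EFin \o (fun x : R => (\sum_(e | dtl N e == dsnk N) f e (x + 0))%R)))%E).
  by apply: integrableB => //; exact: integrable_sumf.
apply/funext => x /=; rewrite EFinB; congr (_%:E - _%:E)%E; apply: eq_bigr => e _.
  exact: arrival_constE.
by rewrite addr0.
Qed.

Lemma flow_value_fin_num : flow_value N f \is a fin_num.
Proof.
exact: integrable_fin_num integrable_excess.
Qed.

(** Integrates [sink_excessE], then translates the term of each edge by its transit time, from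
    arrival to entering times. *)
Let value_side :
  (flow_value N f + X =
   \int[mu]_(x in I) (\sum_e side (dhd N e) (x + tau e) * f e x)%:E)%E.
Proof.
rewrite /flow_value /X -integralD_EFin //.
transitivity (\int[mu]_(x in I)
    (\sum_e (side (dhd N e) x * f e (x - tau e))%:E))%E.
  by apply: eq_integral => x /[!inE] Ix; rewrite /= -EFinD sink_excessE // sumEFin.
rewrite ge0_integral_sum //; last 2 first.
- move=> e; apply/measurable_EFinP/measurable_funTS.
  exact: measurable_funM (mside0 _) (mfh e _).
- by move=> e x _; rewrite lee_fin mulr_ge0.
transitivity (\int[mu]_(x in I)
    (\sum_e (side (dhd N e) (x + tau e) * f e x)%:E))%E; last first.
  by apply: eq_integral => x _; rewrite sumEFin.
rewrite ge0_integral_sum //; last 2 first.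
- move=> e; apply/measurable_EFinP/measurable_funTS.
  exact: measurable_funM (mside _ _) (mf e).
- by move=> e x _; rewrite lee_fin mulr_ge0.
apply: eq_bigr => e _; rewrite integral_mkcond [RHS]integral_mkcond.
transitivity (\int[mu]_x (side (dhd N e) x * f e (x - tau e))%:E)%E.
  apply: eq_integral => x _; rewrite patchE; case: ifPn => // /negP Ix.
  by rewrite f_late ?mulr0 // => Ix'; apply: Ix; rewrite inE.
rewrite -(ge0_integral_translation (tau e)); last 2 first.
- by apply/measurable_EFinP; exact: measurable_funM (mside0 _) (mfh e _).
- by move=> x; rewrite lee_fin mulr_ge0.
apply: eq_integral => x _; rewrite addrK patchE; case: ifPn => // /negP Ix.
by rewrite f_out ?mulr0 // => Ix'; apply: Ix; rewrite inE.
Qed.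

Let mslack e : measurable_fun setT (slack f S e).
Proof.
have -> : slack f S e = fun x =>
    du N e x * ((1 - side (dtl N e) x) * side (dhd N e) (x + tau e))
    - f e x * (side (dhd N e) (x + tau e) - side (dtl N e) x).
  apply/funext => x; rewrite /slack /side dtauE.
  by case: (S _ _); case: (S _ _) => /=; rewrite ?mulr1n ?mulr0n; ring.
apply: measurable_funB.
  apply: measurable_funM; first exact: mdu.
  apply: measurable_funM (mside _ _).
  exact: measurable_funB (measurable_cst _) (mside0 _).
apply: measurable_funM; first exact: mf.
exact: measurable_funB (mside _ _) (mside0 _).
Qed.

(** By [value_side] the identity reduces to a pointwise one on each edge. As slack is nonnegative,
    weak duality and both directions of complementary slackness follow from it. *)
Lemma cut_capacity_gap :
  (cut_capacity N S =
   flow_value N f + \sum_e \int[mu]_(x in I) (slack f S e x)%:E)%E.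
Proof.
have Xfin : X \is a fin_num by apply: integrable_fin_num.
rewrite -ge0_integral_sum //; last 2 first.
- by move=> e; apply/measurable_EFinP/measurable_funTS; exact: mslack.
- by move=> e x Ix; rewrite lee_fin slack_ge0.
have E (y : \bar R) : (X + (flow_value N f + y) = flow_value N f + X + y)%E.
  by rewrite addeA [(X + _)%E]addeC.
apply: (fin_num_addeI Xfin); rewrite E value_side.
rewrite /cut_capacity /X -!ge0_integralD //.
- apply: eq_integral => x _; rewrite sumEFin -!EFinD; congr EFin.
  rewrite [X in _ + X = _]big_mkcond /= -!big_split /=.
  apply: eq_bigr => e _; rewrite /slack /side dtauE.
  by case: (S _ _); case: (S _ _) => /=; rewrite ?mulr1n ?mulr0n; ring.
- by move=> x _; rewrite lee_fin sumr_ge0 // => e _; rewrite mulr_ge0.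
- apply/measurable_EFinP/measurable_funTS; apply: measurable_sum => e.
  exact: measurable_funM (mside _ _) (mf e).
- by move=> x Ix; apply: sume_ge0 => e _; rewrite lee_fin slack_ge0.
- apply: emeasurable_sum => e; apply/measurable_EFinP/measurable_funTS; exact: mslack.
- by move=> x _; rewrite lee_fin sumr_ge0 // => e _; rewrite mulr_ge0.
- apply/measurable_EFinP/measurable_funTS; apply: measurable_sum => e.
  exact: measurable_funM (mside0 _) (mf e).
- by move=> x _; rewrite lee_fin sumr_ge0.
- apply/measurable_EFinP/measurable_funTS.
  rewrite (_ : (fun x => _) = fun x => \sum_e
     du N e x * ((1 - side (dtl N e) x) * side (dhd N e) (x + tau e))).
    apply: measurable_sum => e; apply: measurable_funM; first exact: mdu.
    apply: measurable_funM (mside _ _).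
    exact: measurable_funB (measurable_cst _) (mside0 _).
  apply/funext => x; rewrite big_mkcond; apply: eq_bigr => e _.
  rewrite /side dtauE.
  by case: (S _ _); case: (S _ _) => /=; rewrite ?mulr1n ?mulr0n; ring.
Qed.

Lemma weak_duality : (flow_value N f <= cut_capacity N S)%E.
Proof.
rewrite cut_capacity_gap leeDl // sume_ge0 // => e _.
by apply: integral_ge0 => x Ix; rewrite lee_fin slack_ge0.
Qed.

Lemma slack_eq0_tight :
  (forall e x, I x -> slack f S e x = 0) -> cut_capacity N S = flow_value N f.
Proof.
move=> s0; rewrite cut_capacity_gap big1 ?adde0 // => e _.
by apply: integral0_eq => x Ix; rewrite s0.
Qed.

(** The slack integrals are nonnegative with sum 0, so each slack vanishes almost everywhere;
    finitely many edges share one null set. *)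
Lemma complementary_slackness : cut_capacity N S = flow_value N f ->
  \forall x \ae mu, forall e, I x -> slack f S e x = 0.
Proof.
move=> CV.
have sl0 e : (0 <= \int[mu]_(x in I) (slack f S e x)%:E)%E.
  by apply: integral_ge0 => x Ix; rewrite lee_fin slack_ge0.
have sum0 : (\sum_e \int[mu]_(x in I) (slack f S e x)%:E = 0)%E.
  apply: (@fin_num_addeI _ (flow_value N f)); first exact: flow_value_fin_num.
  by rewrite adde0 -cut_capacity_gap CV.
have each e : \forall x \ae mu, I x -> slack f S e x = 0.
  have ie : (\int[mu]_(x in I) (slack f S e x)%:E = 0)%E.
    apply/eqP; rewrite eq_le sl0 andbT -sum0 (bigD1 e) //= leeDl // sume_ge0 //.
  have /(@ae_eq_integral_abs _ _ _ mu I mI) : measurable_fun I (EFin \o slack f S e).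
    by apply/measurable_EFinP/measurable_funTS; exact: mslack.
  case=> /(_ _) ae0 _.
  have : ae_eq mu I (EFin \o slack f S e) (cst 0%E).
    apply: ae0; rewrite -[RHS]ie; apply: eq_integral => x /[!inE] Ix /=.
    by rewrite ger0_norm ?slack_ge0.
  by apply: filterS => x H /H /= -[].
by apply: filter_forall.
Qed.

End Gap.
End Duality.

(** A countable union of translated null sets is null and cannot cover the unit interval, which has
    measure 1. *)
Lemma ae_integer_translates (R : realType) (P : R -> Prop) :
  (\forall x \ae @lebesgue_measure R, P x) ->
  exists2 y : R, 0 < y < 1 & forall n : nat, P (y + n%:R).
Proof.
move=> aeP.
have [A [mA A0 PA]] : \forall y \ae @lebesgue_measure R, forall n : nat, P (y + n%:R).
  by apply: ae_foralln => n; exact: ae_translation.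
apply: contrapT => noy.
have subA : `]0%R, 1%R[%classic `<=` A.
  move=> y /=; rewrite in_itv /= => y01; apply: PA => Py; apply: noy.
  by exists y.
have : (@lebesgue_measure R `]0%R, 1%R[%classic <= lebesgue_measure A)%E.
  by apply: le_measure => //; rewrite inE.
by rewrite A0 [X in (X <= _)%E]lebesgue_measure_itv /= lte_fin ltr01 oppr0 adde0 lee_fin ler10.
Qed.

(** * Counting the changes of a function *)

Section Changes.
Variables (R : realType) (T : eqType).
Implicit Types (D : set R) (g : R -> T).

Lemma has_changes_leq D g m n : (m <= n)%N -> has_changes D g n -> has_changes D g m.
Proof.
move=> mn [x [Dx [xlt xne]]]; exists x; split.
  by move=> i im; apply: Dx; exact: leq_trans im mn.
by split => i im; [apply: xlt|apply: xne]; exact: leq_trans im mn.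
Qed.

(** The number [phi] of predicates that hold never decreases and grows at every change; it is at
    most [m], so [m.+1] changes do not fit. *)
Lemma no_changes_steps D g m (P : nat -> R -> bool) :
  (forall i x y, x <= y -> P i x -> P i y) ->
  (forall x y, (forall i, (i < m)%N -> P i x = P i y) -> g x = g y) ->
  ~ has_changes D g m.+1.
Proof.
move=> Pup gP [x [_ [xlt xne]]].
pose phi z := (\sum_(i < m) P i z)%N.
have phi_ge i : (i <= m.+1)%N -> (i <= phi (x i))%N.
  elim: i => // i IH im; apply: leq_ltn_trans (IH (ltnW im)) _.
  have : (phi (x i) <= phi (x i.+1) ?=
      iff [forall j : 'I_m, P j (x i) == P j (x i.+1)])%N.
    apply: leqif_sum => j _; split; last by case: (P _ _); case: (P _ _).
    by have := @Pup j _ _ (ltW (xlt _ im)); case: (P _ _); case: (P _ _) => // /(_ isT).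
  move=> /ltn_leqif ->; apply/negP => /forallP same.
  have /eqP := xne _ im; apply; apply: gP => j jm.
  exact/eqP/(same (Ordinal jm)).
have := phi_ge m.+1 (leqnn _); rewrite leqNgt ltnS => /negP; apply.
rewrite -[X in (_ <= X)%N]card_ord -sum1_card; apply: leq_sum => j _; exact: leq_b1.
Qed.

(** Lets the lower bound be read off the middle chain vertex [x_k] alone. *)
Lemma family_changes_ge_has_changes (I : finType) D (h : I -> R -> T) i L :
  has_changes D (h i) L -> family_changes_ge D h L.
Proof.
move=> hi K [m [nm sm]]; apply: leq_trans sm; rewrite (bigD1 i) //=.
apply: leq_trans (leq_addr _ _); rewrite leqNgt; apply/negP => mL.
exact: nm i (has_changes_leq mL hi).
Qed.

End Changes.

(** Along a cycle the tails would increase strictly and yet return to the first. *)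
Lemma acyclic_topological (N : cnet) :
  (forall e, (tl N e < hd N e)%N) -> acyclic N.
Proof.
move=> lt_th [m [es [m0 cyc]]].
have step i : (i < m)%N -> (tl N (es i) < tl N (es (i.+1 %% m)%N))%N.
  by move=> im; rewrite -(cyc i im).
have ge0 i : (i < m)%N -> (tl N (es 0%N) <= tl N (es i))%N.
  elim: i => // i IH im; apply: leq_trans (IH (ltnW im)) _.
  by have := step i (ltnW im); rewrite modn_small // => /ltnW.
have := step m.-1; rewrite prednK // modnn leqnn => /(_ isT).
by rewrite ltnNge ge0 // ltn_predL.
Qed.

Lemma measurable_du_cap_change_net (R : realType) (N : cnet) e :
  measurable_fun setT (du (cap_change_net R N) e).
Proof.
rewrite /=; case: (e == ch_edge N) => /=; last exact: measurable_cst.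
apply: measurable_fun_ifT => //.
exact: measurable_fun_ler.
Qed.

(** * The chain network, its acyclicity and its size *)

Section Network.
Local Open Scope nat_scope.

(* Vertices: 0 is the source, 1 a relay, 2, ..., 2k+2 the chain x_0, ..., x_2k
   and 2k+3 the sink.  Edges 0-4 are s->a, a->x_0, x_0->t, a->x_2k and x_2k->t;
   edges 5+2i and 6+2i join x_i to x_(i+1), undelayed and delayed. *)
Definition edge_tl (k e : nat) : nat :=
  match e with
  | 0 => 0 | 1 => 1 | 2 => 2 | 3 => 1 | 4 => (2 * k).+2
  | n.+4.+1 => n./2.+2
  end.

Definition edge_hd (k e : nat) : nat :=
  match e with
  | 0 => 1 | 1 => 2 | 2 => (2 * k).+3 | 3 => (2 * k).+2 | 4 => (2 * k).+3
  | n.+4.+1 => n./2.+3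
  end.

(* The powers of two rise along the first half of the chain and fall along the
   second, so both x_0 and x_2k are joined to x_k by every delay 2j, j < 2^k. *)
Definition edge_tau (k e : nat) : nat :=
  match e with
  | 0 => 0 | 1 => 0 | 2 => 2 * 2 ^ k | 3 => 2 * 2 ^ k - 2 | 4 => 0
  | n.+4.+1 => if odd n then 2 * 2 ^ minn n./2 (2 * k - n./2.+1) else 0
  end.

(** Capacity 2 lets the edge into the relay feed both unit edges out of it. *)
Definition edge_cap (e : nat) : nat := if e == 0 then 2 else 1.

(** The parameter [v] is the value after the change, so one construction serves both variants:
    capacity 0, or transit time [4 * 2 ^ k], which exceeds the horizon. *)
Definition chain_net (v k : nat) : cnet :=
  @CNet (2 * k).+4 (4 * k).+4.+1
    (fun e => inord (edge_tl k e)) (fun e => inord (edge_hd k e)) ord0 ord_max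
    (4 * 2 ^ k - 1) (fun e => edge_tau k e) (fun e => edge_cap e)
    ord0 (2 * 2 ^ k) v.

Lemma edge_tl_lt k e : e < (4 * k).+4.+1 -> edge_tl k e < (2 * k).+4.
Proof. by case: e => [|[|[|[|[|n]]]]] //=; lia. Qed.

Lemma edge_hd_lt k e : e < (4 * k).+4.+1 -> edge_hd k e < (2 * k).+4.
Proof. by case: e => [|[|[|[|[|n]]]]] //=; lia. Qed.

Lemma edge_tl_lt_hd k e : edge_tl k e < edge_hd k e.
Proof. by case: e => [|[|[|[|[|n]]]]] //=. Qed.

Lemma acyclic_chain_net v k : acyclic (chain_net v k).
Proof.
apply: acyclic_topological => e /=.
by rewrite !inordK ?edge_tl_lt_hd // ?edge_tl_lt ?edge_hd_lt.
Qed.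

Lemma bits_le x n : x < 2 ^ n -> bits x <= n.+1.
Proof.
case: x => [|x] xn; first by rewrite /bits trunc_log0.
rewrite /bits ltnS -(@leq_exp2l 2) //.
by apply: leq_trans (ltnW xn); exact: trunc_logP.
Qed.

Lemma edge_tau_lt k e : e < (4 * k).+4.+1 -> edge_tau k e < 2 ^ k.+2.
Proof.
have K0 : 0 < 2 ^ k by rewrite expn_gt0.
rewrite !expnS; case: e => [|[|[|[|[|n]]]]] /=; try lia.
move=> nk; case: ifP => _; last lia.
have : 2 ^ minn n./2 (2 * k - n./2.+1) <= 2 ^ k by rewrite leq_exp2l //; lia.
lia.
Qed.

Lemma net_size_chain_net v k : 0 < k -> v < 2 ^ k.+2.+1 ->
  net_size (chain_net v k) <= 200 * k ^ 200.
Proof.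
move=> k0 vk.
have K0 : 0 < 2 ^ k by rewrite expn_gt0.
have bh : bits (4 * 2 ^ k - 1) <= k.+3 by apply: bits_le; rewrite !expnS; lia.
have bt : bits (2 * 2 ^ k) <= k.+3 by apply: bits_le; rewrite !expnS; lia.
have bv : bits v <= k.+4 by apply: bits_le.
have : \sum_(e < (4 * k).+4.+1) (bits (edge_tau k e) + bits (edge_cap e)) <=
   \sum_(e < (4 * k).+4.+1) (k.+3 + 3).
  apply: leq_sum => e _; apply: leq_add; first exact/bits_le/edge_tau_lt.
  by apply: bits_le; rewrite /edge_cap; case: ifP.
rewrite sum_nat_const card_ord /net_size /= => bs.
(* The size is at most quadratic in [k]; the exponent 200 appears because the theorem uses a single
   constant as factor and exponent. *)
apply: (@leq_trans (200 * (k * k))); first by nia.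
by rewrite leq_mul2l mulnn leq_pexp2l.
Qed.

End Network.

(** * An optimal flow and an optimal cut for the capacity change *)

Section MinCut.
Variables (R : realType) (k : nat).
Hypothesis k_gt0 : (0 < k)%N.
Local Notation K := ((2 ^ k)%:R : R).
Local Notation N := (cap_change_net R (chain_net 0 k)).

Let K_ge2 : 2 <= K.
Proof. by rewrite (ler_nat _ 2) -[X in (X <= _)%N]expn1 leq_exp2l. Qed.

Let K_gt0 : (0 < 2 ^ k)%N. Proof. by rewrite expn_gt0. Qed.

Lemma change_timeE : (2 * 2 ^ k)%:R = 2 * K. Proof. by rewrite natrM. Qed.

Lemma horizonE : (4 * 2 ^ k - 1)%:R = 4 * K - 1.
Proof. by rewrite natrB ?natrM //; lia. Qed.

Lemma relay_delayE : (2 * 2 ^ k - 2)%:R = 2 * K - 2.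
Proof. by rewrite natrB ?natrM //; lia. Qed.

(** The closed end keeps edge 1 saturated at [2 * K - 1], outside the open windows of the cut; the
    open end of [long_pulse] respects the capacity drop at [2 * K]. *)
Definition short_pulse (x : R) : R := ((0 <= x) && (x <= 2 * K - 1))%:R.
Definition long_pulse (x : R) : R := ((0 <= x) && (x < 2 * K))%:R.

Definition edge_flow (e : nat) (x : R) : R :=
  match e with
  | 0%N => short_pulse x + long_pulse x
  | 1%N | 2%N => short_pulse x
  | 3%N => long_pulse x
  | 4%N => long_pulse (x - (2 * K - 2))
  | _ => 0
  end.

Definition chain_flow (e : 'I_(dE N)) (x : R) : R := edge_flow e x.

(* With open intervals the slack of every edge vanishes at all times, not just
   almost everywhere. *)
Definition odd_window (x : R) : bool :=
  [exists j : 'I_(2 ^ k), (2 * (K + j%:R) - 1 < x) && (x < 2 * (K + j%:R))].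

(** The first disjunct is the convention past the horizon. The relay changes side when edge 0 loses
    its capacity, and all chain vertices use the same windows. *)
Definition vertex_side (v : nat) (x : R) : bool :=
  (4 * K - 1 < x) ||
  (if v == 0%N then true else if v == 1%N then x < 2 * K
   else if v == (2 * k).+3 then false else odd_window x).

Definition chain_cut (v : 'I_(dV N)) (x : R) : bool := vertex_side v x.

Lemma measurable_pulse (a b : R) (c : bool) :
  measurable [set x : R | (a <= x) && (if c then x <= b else x < b)].
Proof.
by case: c; [exact: (measurable_itv `[a, b]) | exact: (measurable_itv `[a, b[)].
Qed.

Lemma measurable_short_pulse : measurable_fun setT short_pulse.
Proof. by apply: measurable_fun_boolr; exact: (measurable_pulse _ _ true). Qed.

Lemma measurable_long_pulse : measurable_fun setT long_pulse.
Proof. by apply: measurable_fun_boolr; exact: (measurable_pulse _ _ false). Qed.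

Lemma short_pulse_out x : (x < 0) || (2 * K - 1 < x) -> short_pulse x = 0.
Proof.
rewrite /short_pulse => /orP[] xo; first by rewrite (lt_geF xo).
by rewrite (lt_geF xo) andbF.
Qed.

Lemma long_pulse_out x : (x < 0) || (2 * K <= x) -> long_pulse x = 0.
Proof.
rewrite /long_pulse => /orP[] xo; first by rewrite (lt_geF xo).
by rewrite (le_gtF xo) andbF.
Qed.

(** Only the first five edges carry flow, which makes the sums in flow conservation explicit. *)
Lemma sum_edges (P : pred 'I_(4 * k).+4.+1) (g : 'I_(4 * k).+4.+1 -> R) :
  (forall e : 'I_(4 * k).+4.+1, (5 <= e)%N -> g e = 0) ->
  \sum_(e | P e) g e =
  \sum_(i < 5) (if P (inord i) then g (inord i) else 0).
Proof.
move=> g0; rewrite big_mkcond /= (eq_bigr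
  (fun e : 'I__ => if P (inord e) then g (inord e) else 0)); last first.
  by move=> e _; rewrite inord_val.
rewrite -(big_mkord xpredT (fun e => if P (inord e) then g (inord e) else 0)).
rewrite (@big_cat_nat _ _ _ 5) //= big_mkord [X in _ + X]big_nat_cond [X in _ + X]big1 ?addr0 //.
move=> e /andP[/andP[e5 elt] _]; case: ifP => // _.
by rewrite g0 // inordK.
Qed.

Lemma chain_flow_is_dyn_flow : is_dyn_flow N chain_flow.
Proof.
have p0 (b : bool) : 0 <= b%:R :> R by rewrite ler0n.
split; first move=> [[|[|[|[|[|n]]]]] lt].
- exact: measurable_funD measurable_short_pulse measurable_long_pulse.
- exact: measurable_short_pulse.
- exact: measurable_short_pulse.
- exact: measurable_long_pulse.
- exact: measurableT_comp measurable_long_pulse (measurable_translation _).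
- exact: measurable_cst.
split.
  by move=> [[|[|[|[|[|n]]]]] lt] x; rewrite /chain_flow /= ?addr_ge0.
split.
  move=> e x; rewrite /Tint /= in_itv /= horizonE => /andP[x0 xT].
  case: e => [[|[|[|[|[|n]]]]] /= lt]; rewrite -?val_eqE /= /chain_flow /=
    /short_pulse /long_pulse /edge_cap /= ?change_timeE ?lern1 ?leq_b1 ?ler0n //.
  (* Edge 0: both pulses together need capacity 2, and both are over at [2 * K], when the capacity
     becomes 0. *)
  have [] := leP (2 * K) x; have [] := leP x (2 * K - 1) => /= *; rewrite ?andbF ?andbT ?x0 /=; lra.
have K2 := K_ge2.
split.
  move=> [[|[|[|[|[|n]]]]] lt] x x0; rewrite /chain_flow /=
    ?short_pulse_out ?long_pulse_out ?x0 ?addr0 //.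
  by apply/orP; left; lra.
split.
  move=> [[|[|[|[|[|n]]]]] lt] x; rewrite /chain_flow /= horizonE ?relay_delayE
    ?change_timeE => xT; rewrite ?short_pulse_out ?long_pulse_out ?addr0 //;
    by apply/orP; right; lra.
move=> v th vs vt.
have arr e : arrival N chain_flow e th = chain_flow e (th - (edge_tau k e)%:R).
  exact: (arrival_constE (tau := fun e : 'I_(dE N) => (edge_tau k e)%:R)).
under eq_bigr do rewrite arr.
rewrite !sum_edges; last 2 first.
- by move=> [[|[|[|[|[|n]]]]] lt].
- by move=> [[|[|[|[|[|n]]]]] lt].
rewrite !big_ord_recl !big_ord0 /= /chain_flow !inordK //= -?val_eqE /= !inordK //=; try lia.
rewrite !subr0 relay_delayE !addr0.
have v0 : (0%N == v :> nat) = false by apply/negbTE; rewrite eq_sym.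
have vT : ((2 * k).+3 == v :> nat) = false by apply/negbTE; rewrite eq_sym.
rewrite v0 vT !add0r.
(* At the relay the two outgoing pulses sum to the incoming flow; at the other vertices the incoming
   and outgoing terms now coincide. *)
have [v1|_] := eqVneq 1%N (v : nat).
  by rewrite -v1 /= !(addr0, add0r).
by rewrite !(addr0, add0r).
Qed.

(** The windows have period 2, so an even delay maps a window onto a window; the bound on the
    arrival time excludes any beyond the last one. *)
Lemma odd_window_shift x m :
  odd_window x -> x + (2 * m)%:R <= 4 * K - 1 -> odd_window (x + (2 * m)%:R).
Proof.
move=> /existsP[j /andP[jl jr]]; rewrite natrM => xT.
have jm : (j + m < 2 ^ k)%N.
  rewrite -(ltr_nat R) natrD.
  have : (2 * (2 ^ k + j + m) < 4 * 2 ^ k)%N by rewrite -(ltr_nat R) !natrM !natrD; lra.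
  by rewrite -(ltr_nat R) !natrM !natrD; lra.
apply/existsP; exists (Ordinal jm); rewrite /= natrD; apply/andP; split; lra.
Qed.

Lemma odd_window_bounds x : odd_window x -> 2 * K - 1 < x < 4 * K - 2.
Proof.
move=> /existsP[j /andP[jl jr]].
have : 0 <= j%:R :> R by rewrite ler0n.
have : j.+1%:R <= K by rewrite ler_nat.
rewrite -natr1 => *; apply/andP; split; lra.
Qed.

Lemma odd_window_first x : 2 * K - 1 < x -> x < 2 * K -> odd_window x.
Proof.
move=> xl xr; apply/existsP; exists (Ordinal K_gt0) => /=.
by rewrite addr0 xl xr.
Qed.

Lemma measurable_odd_window : measurable [set x | odd_window x].
Proof.
rewrite (_ : mkset _ = \bigcup_(j in [set: 'I_(2 ^ k)])
    `](2 * (K + j%:R) - 1), (2 * (K + j%:R))[%classic).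
  by apply: fin_bigcup_measurable => //; exact: finite_finset.
apply/seteqP; split => x /=.
  by move=> /existsP[j jx]; exists j => //=; rewrite in_itv.
by move=> [j _] /=; rewrite in_itv /= => jx; apply/existsP; exists j.
Qed.

Lemma chain_cut_is_dyn_cut : is_dyn_cut N chain_cut.
Proof.
split.
  move=> v; rewrite /chain_cut /vertex_side.
  have mT : measurable [set x : R | 4 * K - 1 < x].
    rewrite (_ : mkset _ = `](4 * K - 1), +oo[%classic); first exact: measurable_itv.
    by apply/seteqP; split => x /=; rewrite in_itv /= andbT.
  have mc : measurable [set x : R | x < 2 * K].
    exact: (measurable_itv `]-oo, (2 * K)[).
  rewrite (_ : mkset _ = [set x : R | 4 * K - 1 < x] `|` [set x |
     if v == 0%N :> nat then true else if v == 1%N :> nat then x < 2 * K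
     else if v == (2 * k).+3 :> nat then false else odd_window x]).
    apply: measurableU => //; case: (_ == 0%N) => /=.
      by rewrite (_ : mkset _ = setT) //; apply/seteqP; split.
    case: (_ == 1%N); first exact: mc.
    case: (_ == (2 * k).+3); last exact: measurable_odd_window.
    by rewrite (_ : mkset _ = set0) //; apply/seteqP; split.
  by apply/seteqP; split => x /= => [/orP|/orP].
split; first by move=> x _; rewrite /chain_cut /vertex_side /= orbT.
split.
  move=> x; rewrite /Tint /= in_itv /= horizonE => /andP[_ xT].
  by rewrite /chain_cut /vertex_side /= eqxx orbF ltNge xT.
by move=> v x /=; rewrite horizonE => xT; rewrite /chain_cut /vertex_side xT.
Qed.

(** Edges 0 to 4 are saturated or empty as far as their two sides demand; the chain edges are empty
    and never lead to the sink side, by [odd_window_shift]. *)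
Lemma chain_slack_eq0 e x : Tint N x -> slack (N := N) chain_flow chain_cut e x = 0.
Proof.
rewrite /Tint /= in_itv /= horizonE => /andP[x0 xT].
rewrite /slack /= /chain_cut !inordK ?edge_tl_lt ?edge_hd_lt // -?val_eqE /=.
have xTF : (4 * K - 1 < x) = false by rewrite ltNge xT.
case: e => [[|[|[|[|[|n]]]]] /= lt]; rewrite /chain_flow /vertex_side /= ?xTF
  ?addr0 ?xTF /edge_cap /= ?change_timeE ?relay_delayE ?eqSS.
- rewrite /short_pulse /long_pulse x0 /=.
  have [] := leP (2 * K) x; have [] := leP x (2 * K - 1) => /= *; lra.
- rewrite /short_pulse x0 /=.
  have [xc|xc] := leP x (2 * K - 1).
    rewrite (_ : x < 2 * K) /=; last lra.
    rewrite (_ : odd_window x = false) /=; first by ring.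
    by apply/negbTE/negP => /odd_window_bounds/andP[]; lra.
  have [xc2|xc2] := leP (2 * K) x; first by rewrite /=; ring.
  by rewrite odd_window_first //=; ring.
- rewrite eqxx /= !orbF /short_pulse x0 /=.
  have [xc|xc] := leP x (2 * K - 1).
    rewrite (_ : odd_window x = false) /=; last first.
      by apply/negbTE/negP => /odd_window_bounds/andP[]; lra.
    rewrite (_ : (4 * K - 1 < x + 2 * K) = false) /=; first by ring.
    by apply/negbTE; rewrite -leNgt; lra.
  (* Flow entering now would arrive after the horizon, where the sink counts as on the source
     side. *)
  rewrite (_ : (4 * K - 1 < x + 2 * K) = true) /= ?andbF /=; first by ring.
  by lra.
(* Edge 3 is saturated exactly while the relay is on the source side, so either side of its head
   gives slack 0. *)
- rewrite (_ : (2 * k == (2 * k).+1)%N = false) /=; last by apply/negbTE; lia.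
  rewrite /long_pulse x0 /=.
  have [xc|xc] := leP (2 * K) x; first by rewrite /=; ring.
  by case: (_ || _) => /=; ring.
- rewrite eqxx (_ : (2 * k == (2 * k).+1)%N = false) /=; last by apply/negbTE; lia.
  rewrite andbT /long_pulse.
  case: (boolP (odd_window x)) => [/odd_window_bounds /andP[xl xr]|_] /=; last by ring.
  rewrite (_ : (0 <= x - (2 * K - 2)) = true) /=; last by lra.
  by rewrite (_ : (x - (2 * K - 2) < 2 * K) = true) /=; [ring|lra].
- have nk : (n./2 < 2 * k)%N by lia.
  rewrite (_ : (n./2 == (2 * k).+1) = false); last by apply/negbTE; lia.
  rewrite (_ : (n./2 == 2 * k)%N = false) /=; last by apply/negbTE; lia.
  rewrite mul0r subr0; case: (boolP (odd_window x)) => [wx|_] /=; last by rewrite mulr0.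
  case: ltP => [_|xT'] /=; first by rewrite mulr0.
  have -> : odd_window (x + (if odd n then 2 * 2 ^ minn n./2 (2 * k - n./2.+1) else 0)%N%:R).
    by move: xT'; case: ifP => _ xT'; [exact: odd_window_shift | rewrite addr0].
  by rewrite mulr0.
Qed.


Let tauE (e : 'I_(dE N)) : R := (edge_tau k e)%:R.

Let tauE_ge0 e : 0 <= tauE e. Proof. exact: ler0n. Qed.

Let du_ge0 e x : 0 <= du N e x. Proof. by rewrite /=; case: ifP => _; rewrite ler0n. Qed.

Let du_le2 e x : du N e x <= 2.
Proof.
by rewrite /=; case: ifP => _; rewrite (ler_nat _ _ 2) // /edge_cap; case: ifP.
Qed.

Let mdu e : measurable_fun setT (du N e).
Proof. exact: (@measurable_du_cap_change_net R (chain_net 0 k) e). Qed.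

Lemma chain_cut_tight : cut_capacity N chain_cut = flow_value N chain_flow.
Proof.
exact: (slack_eq0_tight tauE_ge0 (fun _ _ => erefl) mdu du_ge0 du_le2
  chain_flow_is_dyn_flow chain_cut_is_dyn_cut chain_slack_eq0).
Qed.

Lemma chain_cut_is_min_cut : is_min_cut N chain_cut.
Proof.
split; first exact: chain_cut_is_dyn_cut.
move=> S cS; rewrite chain_cut_tight.
exact: (weak_duality tauE_ge0 (fun _ _ => erefl) mdu du_ge0 du_le2
  chain_flow_is_dyn_flow cS).
Qed.

Lemma chain_flow_is_max_flow : is_max_flow N chain_flow.
Proof.
split; first exact: chain_flow_is_dyn_flow.
move=> g fg; rewrite -chain_cut_tight.
exact: (weak_duality tauE_ge0 (fun _ _ => erefl) mdu du_ge0 du_le2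
  fg chain_cut_is_dyn_cut).
Qed.

(** Five thresholds determine every edge function, so each changes at most five times. The parameter
    [v] enters only in the size, for use in both variants. *)
Lemma chain_flow_complexity v :
  flow_complexity_le chain_flow (200 * net_size (chain_net v k)).
Proof.
exists (fun=> 5%N); split; last first.
  by rewrite sum_nat_const card_ord /net_size /=; lia.
move=> e; apply: (@no_changes_steps R R setT (chain_flow e) 5 (fun i x =>
  match i with
  | 0%N => 0 <= x | 1%N => 2 * K - 1 < x | 2%N => 2 * K <= x
  | 3%N => 2 * K - 2 <= x | _ => 4 * K - 2 <= x
  end)).
  by move=> [|[|[|[|i]]]] x y xy ?; lra.
move=> x y same.
have e1 := same 0%N isT; have e2 := same 1%N isT; have e3 := same 2%N isT.
have e4 := same 3%N isT; have e5 := same 4%N isT; cbn in e1, e2, e3, e4, e5.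
have es : short_pulse x = short_pulse y by rewrite /short_pulse e1 ![(_ <= _ - _)]leNgt e2.
have el : long_pulse x = long_pulse y by rewrite /long_pulse e1 ![(_ < 2 * K)]ltNge e3.
have ed : long_pulse (x - (2 * K - 2)) = long_pulse (y - (2 * K - 2)).
  rewrite /long_pulse !subr_ge0 e4 !ltrBlDr !ltNge.
  by rewrite (_ : 2 * K + (2 * K - 2) = 4 * K - 2) ?e5 //; ring.
by case: e => [[|[|[|[|[|n]]]]] lt]; rewrite /chain_flow /= ?es ?el ?ed.
Qed.

(** * Exponential lower bound on the complexity of any minimum cut *)

Section LowerBound.
Variable S : 'I_(dV N) -> R -> bool.
Hypothesis minS : is_min_cut N S.

Let cutS : is_dyn_cut N S. Proof. by case: minS. Qed.

Lemma min_cut_tight : cut_capacity N S = flow_value N chain_flow.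
Proof.
rewrite -chain_cut_tight; apply/le_anti/andP; split.
  by have [_] := minS; apply; exact: chain_cut_is_dyn_cut.
by have [_] := chain_cut_is_min_cut; apply.
Qed.

Section Sample.
Variable y : R.
Hypotheses (y01 : 0 < y < 1)
  (slack0 : forall n e, Tint N (y + n%:R) ->
    slack (N := N) chain_flow S e (y + n%:R) = 0).
Local Notation x_ i := (inord i.+2 : 'I_(dV N)).

Let sample_in n : (n < 4 * 2 ^ k - 1)%N -> Tint N (y + n%:R).
Proof.
move=> nT; rewrite /Tint /= in_itv /=.
have : n.+1%:R <= (4 * 2 ^ k - 1)%:R :> R by rewrite ler_nat.
have : 0 <= n%:R :> R by rewrite ler0n.
by case/andP: y01 => y0 y1; rewrite -natr1 => *; apply/andP; split; lra.
Qed.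

Let sample_slack n (e : nat) : (n < 4 * 2 ^ k - 1)%N ->
  slack (N := N) chain_flow S (inord e : 'I_(dE N)) (y + n%:R) = 0.
Proof. by move=> nT; apply: slack0; exact: sample_in. Qed.

(** A chain edge has unit capacity and no flow, so slack 0 forbids leaving the source side along it.
    The flag [b] selects the delayed edge. *)
Let chain_step i n (b : bool) : (i < 2 * k)%N -> (n < 4 * 2 ^ k - 1)%N ->
  S (x_ i) (y + n%:R) ->
  S (x_ i.+1) (y + (n + (if b then 2 * 2 ^ minn i (2 * k - i.+1) else 0)%N)%:R).
Proof.
move=> ik nT Sx.
have lt : ((i.*2 + b).+4.+1 < (4 * k).+4.+1)%N by case: b; lia.
have := sample_slack (i.*2 + b).+4.+1 nT; rewrite /slack /= /chain_flow !inordK //=.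
rewrite (_ : (i.*2 + b)./2 = i); last by clear; case: b; lia.
rewrite (_ : odd (i.*2 + b) = b); last by clear; case: b; lia.
rewrite -val_eqE /= inordK //= Sx mul0r subr0 mul1r /= natrD addrA.
by case: (S _ _) => //= /eqP; rewrite oner_eq0.
Qed.

(** In the last unit interval before the change, edge 0 carries 1 of its capacity 2 and edge 1 is
    empty, so slack 0 forces first the relay and then [x_0] to the source side. *)
Lemma sample_source_pulse : S (x_ 0) (y + (2 * 2 ^ k - 1)%:R).
Proof.
have nT : (2 * 2 ^ k - 1 < 4 * 2 ^ k - 1)%N by lia.
have cE : (2 * 2 ^ k - 1)%:R = 2 * K - 1 by rewrite natrB ?natrM //; lia.
have [_ [Ss _]] := cutS; have := Ss _ (sample_in nT) => /= {}Ss.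
case/andP: y01 => y0 y1; have K2 := K_ge2.
have sp : short_pulse (y + (2 * 2 ^ k - 1)%:R) = 0.
  by apply: short_pulse_out; apply/orP; right; rewrite cE; lra.
have lp : long_pulse (y + (2 * 2 ^ k - 1)%:R) = 1.
  rewrite /long_pulse (_ : _ && _ = true) //; apply/andP; rewrite cE; split; lra.
have := sample_slack 0 nT.
rewrite /slack /= /chain_flow !inordK //= -val_eqE /= inordK //= addr0.
rewrite sp lp change_timeE (_ : (2 * K <= _) = false); last first.
  by apply/negbTE; rewrite -ltNge cE; lra.
rewrite (_ : inord 0 = ord0); last by apply: val_inj; rewrite /= inordK.
rewrite Ss /edge_cap /=; case Sa : (S _ _) => /=; last by lra.
move=> _.
have := sample_slack 1 nT.
rewrite /slack /= /chain_flow !inordK //= -val_eqE /= inordK //= addr0.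
by rewrite sp Sa; case: (S _ _) => //=; rewrite /edge_cap /=; lra.
Qed.

(** At the last sample within the horizon edge 4 is empty, so its tail cannot be on the source side
    while the sink is not. *)
Lemma sample_sink_pulse : S (x_ (2 * k)) (y + (4 * 2 ^ k - 2)%:R) = false.
Proof.
have nT : (4 * 2 ^ k - 2 < 4 * 2 ^ k - 1)%N by lia.
have cE : (4 * 2 ^ k - 2)%:R = 4 * K - 2 by rewrite natrB ?natrM //; lia.
have [_ [_ [St _]]] := cutS; have := St _ (sample_in nT) => /= {}St.
case/andP: y01 => y0 y1.
have lp : long_pulse (y + (4 * 2 ^ k - 2)%:R - (2 * K - 2)) = 0.
  by apply: long_pulse_out; apply/orP; right; rewrite cE; lra.
have := sample_slack 4 nT.
rewrite /slack /= /chain_flow !inordK //= -val_eqE /= inordK //= addr0.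
rewrite lp (_ : inord (2 * k).+3 = ord_max); last by apply: val_inj; rewrite /= inordK.
by rewrite St /edge_cap /=; case: (S _ _) => //=; lra.
Qed.

(** The binary digits of [j] tell which of the delays 2, 4, ..., [2 ^ i] to take; the induction
    splits off the leading digit. *)
Lemma sample_up i j : (i <= k)%N -> (j < 2 ^ i)%N ->
  S (x_ i) (y + (2 * 2 ^ k - 1 + 2 * j)%:R).
Proof.
elim: i j => [|i IH] j ik.
  by rewrite expn0 ltnS leqn0 => /eqP ->; rewrite muln0 addn0; exact: sample_source_pulse.
have le_ik : (2 ^ i <= 2 ^ k)%N by rewrite leq_exp2l // ltnW.
have mi : minn i (2 * k - i.+1) = i by lia.
rewrite expnS; case: (ltnP j (2 ^ i)) => [ji _|ji jlt].
  have := @chain_step i (2 * 2 ^ k - 1 + 2 * j) false; rewrite addn0; apply; try lia.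
  by apply: IH => //; exact: ltnW.
have := @chain_step i (2 * 2 ^ k - 1 + 2 * (j - 2 ^ i)) true.
rewrite mi (_ : (_ + 2 * 2 ^ i = 2 * 2 ^ k - 1 + 2 * j)%N); last lia.
by apply; [lia|lia|apply: IH; lia].
Qed.

(** Mirror image of [sample_up], walking back from the sink pulse with the contrapositive of
    [chain_step]; [d] counts the steps from the end of the chain. *)
Lemma sample_down d j : (d <= k)%N -> (j < 2 ^ d)%N ->
  S (x_ (2 * k - d)) (y + (4 * 2 ^ k - 2 - 2 * j)%:R) = false.
Proof.
elim: d j => [|d IH] j dk.
  rewrite expn0 ltnS leqn0 => /eqP ->; rewrite muln0 !subn0.
  exact: sample_sink_pulse.
have le_dk : (2 ^ d <= 2 ^ k)%N by rewrite leq_exp2l // ltnW.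
have sub_d : (2 * k - d = (2 * k - d.+1).+1)%N by lia.
have md : minn (2 * k - d.+1) (2 * k - (2 * k - d.+1).+1) = d by lia.
have IHd j' := IH j' (ltnW dk); rewrite sub_d in IHd.
rewrite expnS; case: (ltnP j (2 ^ d)) => [jd _|jd jlt]; apply/negP => Sx.
  have := @chain_step (2 * k - d.+1) (4 * 2 ^ k - 2 - 2 * j) false.
  by rewrite addn0 IHd // => H; have : false by apply: H => //; lia.
have := @chain_step (2 * k - d.+1) (4 * 2 ^ k - 2 - 2 * j) true.
rewrite md (_ : (_ + 2 * 2 ^ d = 4 * 2 ^ k - 2 - 2 * (j - 2 ^ d))%N); last lia.
by rewrite IHd => [H|]; [have : false by apply: H => //; lia | lia].
Qed.

(** Samples at even [i] are reached from the source pulse, those at odd [i] reach the sink pulse. *)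
Lemma sample_alternates i : (i < 2 * 2 ^ k)%N ->
  S (x_ k) (y + (2 * 2 ^ k - 1 + i)%:R) = ~~ odd i.
Proof.
move=> ilt; case: (boolP (odd i)) => oi /=.
  have := @sample_down k (2 ^ k - 1 - i./2) (leqnn k).
  rewrite (_ : (2 * k - k = k)%N); last lia.
  rewrite (_ : (4 * 2 ^ k - 2 - 2 * _ = 2 * 2 ^ k - 1 + i)%N); last lia.
  by apply; lia.
have := @sample_up k i./2 (leqnn k).
rewrite (_ : (2 * i./2 = i)%N); last lia.
by apply; lia.
Qed.

Lemma sample_has_changes : has_changes (Tint N) (S (x_ k)) (2 * 2 ^ k - 1).
Proof.
exists (fun i => y + (2 * 2 ^ k - 1 + i)%:R); split.
  by move=> i ile; apply: sample_in; lia.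
split=> i ilt; first by rewrite ltrD2l ltr_nat addnS.
by rewrite !sample_alternates; lia.
Qed.

End Sample.

Lemma min_cut_complexity : cut_complexity_ge S (2 ^ (k %/ 200) %/ 200).
Proof.
have := complementary_slackness tauE_ge0 (fun _ _ => erefl) mdu du_ge0 du_le2
  chain_flow_is_dyn_flow cutS min_cut_tight.
move=> /ae_integer_translates[y y01 slack0].
have := sample_has_changes y01 (fun n e => slack0 n e).
move=> /family_changes_ge_has_changes; rewrite /cut_complexity_ge => H m /H.
(* The sampled bound [2 * 2 ^ k - 1] is weakened to the form with the common constant 200. *)
apply: leq_trans; apply: leq_trans (leq_div _ _) _.
have : (2 ^ (k %/ 200) <= 2 ^ k)%N by rewrite leq_exp2l // leq_div.
lia.
Qed.

End LowerBound.
End MinCut.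

(** * Reduction of the transit time change to the capacity change *)

(* Delaying the flow on edge 0 beyond the horizon has the same effect on flows
   and cuts as reducing its capacity to zero. *)
Section TransitChange.
Variables (R : realType) (k : nat).
Local Notation K := ((2 ^ k)%:R : R).
Local Notation C := (cap_change_net R (chain_net 0 k)).
Local Notation D := (tau_change_net R (chain_net (4 * 2 ^ k) k)).

Let K_gt0 : 0 < K. Proof. by rewrite ltr0n expn_gt0. Qed.

(** Satisfied by the flows of both networks: from the change on, edge 0 has capacity 0 in one and
    arrivals past the horizon in the other. *)
Let closed (f : 'I_(4 * k).+4.+1 -> R -> R) :=
  forall x, (2 * 2 ^ k)%:R <= x -> f ord0 x = 0.

Let closed_cap f : is_dyn_flow C f -> closed f.
Proof.
move=> [_ [f0 [fu [_ [fT _]]]]] x cx; have c0 := ler0n R (2 * 2 ^ k).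
have [xT|xT] := leP x (4 * 2 ^ k - 1)%:R; last by apply: fT; rewrite /= addr0.
apply/le_anti; rewrite f0 andbT.
have := fu ord0 x; rewrite /= cx; apply.
by rewrite /Tint /= in_itv /= xT (le_trans c0 cx).
Qed.

Let after_horizon (x : R) : 0 <= x -> (4 * 2 ^ k - 1)%:R < x + (4 * 2 ^ k)%:R.
Proof.
move=> x0; apply: lt_le_trans (_ : (4 * 2 ^ k)%:R <= _); last by rewrite lerDr.
by rewrite ltr_nat; have := expn_gt0 2 k; lia.
Qed.

Let closed_tau f : is_dyn_flow D f -> closed f.
Proof.
move=> [_ [_ [_ [_ [fT _]]]]] x cx; apply: fT; rewrite /= cx.
by apply: after_horizon; exact: le_trans (ler0n R _) cx.
Qed.

Let dtau_tau (e : 'I_(4 * k).+4.+1) x : (e != ord0) || (x < (2 * 2 ^ k)%:R) ->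
  dtau D e x = dtau C e x.
Proof. by rewrite /= leNgt; case: eqP => //= _ ->. Qed.

(** Before the change edge 0 has delay 0 in both networks; later entries contribute nothing,
    whenever they would arrive. *)
Let arrival_tau f e th : closed f -> arrival D f e th = arrival C f e th.
Proof.
move=> cf; rewrite [RHS](arrival_constE (tau := fun e => (edge_tau k e)%:R)) //.
have [->|e0] := eqVneq e ord0; last first.
  rewrite /arrival (_ : [set x | _] = [set th - (edge_tau k e)%:R]) ?fsbig_set1 //.
  apply/seteqP; split => x /=; rewrite (negbTE e0) /=.
    by move=> <-; rewrite addrK.
  by move=> ->; rewrite subrK.
rewrite /= subr0; have [cth|thc] := leP (2 * 2 ^ k)%:R th.
  rewrite cf //; apply: fsbig1 => x /=.
  have [cx _|xc] := leP (2 * 2 ^ k)%:R x; first exact: cf.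
  by rewrite addr0 => xth; move: xc; rewrite xth ltNge cth.
rewrite /arrival (_ : [set x | _] = [set th]) ?fsbig_set1 //.
have v0 := ler0n R (4 * 2 ^ k).
apply/seteqP; split => x /=.
  by case: leP => [cx xth|_]; [move: thc; rewrite -xth ltNge (le_trans cx) // lerDl | rewrite addr0].
by move=> ->; rewrite leNgt thc addr0.
Qed.

(** The two sets of conditions differ only at edge 0 after the change, where [closed] makes them
    agree. *)
Lemma is_dyn_flow_tau f : is_dyn_flow D f <-> is_dyn_flow C f.
Proof.
split=> ff.
- have cf := closed_tau ff; case: ff => [mf [f0 [fu [fl [fT cons]]]]].
  split=> //; split=> //; split.
    move=> e x Ix; rewrite /=; case: ifP => [/andP[/eqP -> cx]|_]; first by rewrite cf.
    exact: fu.
  split=> //; split.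
    move=> e x xT; have [/andP[/eqP -> cx]|] := boolP ((e == ord0) && ((2 * 2 ^ k)%:R <= x)).
      exact: cf.
    by rewrite negb_and -ltNge => eo; apply: fT; rewrite dtau_tau.
  by move=> v th vs vt; rewrite -cons //; apply: eq_bigr => e _; rewrite arrival_tau.
- have cf := closed_cap ff; case: ff => [mf [f0 [fu [fl [fT cons]]]]].
  split=> //; split=> //; split.
    move=> e x Ix; apply: le_trans (fu e x Ix) _.
    by rewrite /=; case: ifP => // _; rewrite ler0n.
  split=> //; split.
    move=> e x xT; have [/andP[/eqP -> cx]|] := boolP ((e == ord0) && ((2 * 2 ^ k)%:R <= x)).
      exact: cf.
    by rewrite negb_and -ltNge => eo; apply: fT; rewrite -dtau_tau.
  by move=> v th vs vt; rewrite -cons //; apply: eq_bigr => e _; rewrite arrival_tau.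
Qed.

Lemma flow_value_tau f : is_dyn_flow C f -> flow_value D f = flow_value C f.
Proof.
move=> /closed_cap cf; apply: eq_integral => x _; congr (_ - _)%:E.
by apply: eq_bigr => e _; exact: arrival_tau.
Qed.

(** After the change edge 0 never counts: one network gives it capacity 0, the other puts its head
    past the horizon, hence on the source side. *)
Lemma cut_capacity_tau S : is_dyn_cut C S -> cut_capacity D S = cut_capacity C S.
Proof.
move=> [_ [_ [_ ST]]]; apply: eq_integral => x; rewrite inE /Tint /= in_itv /= => /andP[x0 _].
congr EFin; rewrite big_mkcond [RHS]big_mkcond /=; apply: eq_bigr => e _.
case: (boolP ((e == ord0) && _)) => // _.
by rewrite [S _ (x + (4 * 2 ^ k)%:R)]ST ?andbF //=; [case: ifP|exact: after_horizon].
Qed.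

Lemma is_min_cut_tau S : is_min_cut D S <-> is_min_cut C S.
Proof.
split=> -[cS minS]; split=> // S' cS'.
  by rewrite -!cut_capacity_tau //; exact: minS.
by rewrite !cut_capacity_tau //; exact: minS.
Qed.

Lemma is_max_flow_tau f : is_max_flow C f -> is_max_flow D f.
Proof.
move=> [ff maxf]; split; first exact/is_dyn_flow_tau.
by move=> g /is_dyn_flow_tau fg; rewrite !flow_value_tau //; exact: maxf.
Qed.

End TransitChange.

(** * Both variants, with 200 as the common constant *)

Theorem theorem6 (R : realType) :
  (exists (Net : nat -> cnet) (c : nat), (0 < c)%N /\
     forall k : nat, (0 < k)%N ->
       let N := Net k in
       acyclic N /\ one_cap_change N /\
       (net_size N <= c * k ^ c)%N /\
       (exists S, is_min_cut (cap_change_net R N) S) /\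
       (forall S, is_min_cut (cap_change_net R N) S ->
          cut_complexity_ge S (2 ^ (k %/ c) %/ c)) /\
       (exists f, is_max_flow (cap_change_net R N) f /\ flow_complexity_le f (c * net_size N))) /\
  (exists (Net : nat -> cnet) (c : nat), (0 < c)%N /\
     forall k : nat, (0 < k)%N ->
       let N := Net k in
       acyclic N /\ one_tau_change N /\
       (net_size N <= c * k ^ c)%N /\
       (exists S, is_min_cut (tau_change_net R N) S) /\
       (forall S, is_min_cut (tau_change_net R N) S ->
          cut_complexity_ge S (2 ^ (k %/ c) %/ c)) /\
       (exists f, is_max_flow (tau_change_net R N) f /\ flow_complexity_le f (c * net_size N))).
Proof.
have times k : (0 < 2 * 2 ^ k < 4 * 2 ^ k - 1)%N by have := expn_gt0 2 k; lia.
split.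
- exists (chain_net 0), 200%N; split=> // k k0 N.
  split; first exact: acyclic_chain_net.
  split; first by split => //; split => //; exact: times.
  split; first by apply: net_size_chain_net => //; rewrite expn_gt0.
  split; first by exists (chain_cut (k := k)); exact: chain_cut_is_min_cut.
  split; first by move=> S /(min_cut_complexity k0).
  exists (chain_flow (k := k)); split; first exact: chain_flow_is_max_flow.
  exact: chain_flow_complexity.
- exists (fun k => chain_net (4 * 2 ^ k) k), 200%N; split=> // k k0 N.
  split; first exact: acyclic_chain_net.
  split; first by split => //; split; [exact: times | rewrite /= -lt0n muln_gt0 expn_gt0].
  split.
    by apply: net_size_chain_net => //; rewrite !expnS; have := expn_gt0 2 k; lia.
  split; first by exists (chain_cut (k := k)); apply/is_min_cut_tau/chain_cut_is_min_cut.
  split; first by move=> S /is_min_cut_tau /(min_cut_complexity k0).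
  exists (chain_flow (k := k)); split.
    exact/is_max_flow_tau/chain_flow_is_max_flow.
  exact: chain_flow_complexity.
Qed.
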